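(* Let $\beta>0$ and $F=F(0,\beta)=\{(j,k)\in\mathbb{Z}^2 : |k|<\beta\}$. Then $F$ has Property A, i.e. $\mathfrak{T}_2^{p}(F-F)=\mathfrak{U}_2(F)$.
   Context: $T=\mathbb{R}/\mathbb{Z}$, $e_{j,k}(x,y)=e^{2\pi i(jx+ky)}$. $\mathfrak{T}_2$ is the algebra of trigonometric polynomials on $T^2$ (finite linear combinations of the $e_{j,k}$); for $t\in\mathfrak{T}_2$, $\mathrm{freq}(t)$ is the set of $(j,k)$ whose Fourier coefficient is nonzero. For $F\subseteq\mathbb{Z}^2$: $\mathfrak{T}_2(F)=\{t\in\mathfrak{T}_2:\mathrm{freq}(t)\subseteq F\}$; $\mathfrak{T}_2^{p}(F)=\{t\in\mathfrak{T}_2(F): t(x,y)>0 \text{ for all }(x,y)\in T^2\}$; $\mathfrak{S}_2(F)=\{|t|^2:t\in\mathfrak{T}_2(F)\}$; $\mathfrak{U}_2(F)=\mathfrak{T}_2\cap \mathrm{cl}(\mathfrak{S}_2(F))$, where the closure is taken in $C(T^2)$ with the supremum norm; $F-F=\{a-b:a,b\in F\}$. $F$ has Property A if $\mathfrak{T}_2^{p}(F-F)=\mathfrak{U}_2(F)$. For $\alpha\in\mathbb{R},\beta>0$, $F(\alpha,\beta)=\{(j,k)\in\mathbb{Z}^2:|k-j\alpha|<\beta\}$.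
   Formalization: The set of positive polynomials is taken with t(x,y) ≥ 0 instead of t(x,y) > 0; with strict positivity the equality fails for every F, since 0 = |0|² lies in U_2(F) but is not > 0. *)

(* Defs.v *)
From HB Require Import structures.
From mathcomp Require Import all_boot all_order all_algebra.
From mathcomp Require Import all_classical all_reals all_analysis.
From mathcomp Require Import complex.

Set Implicit Arguments.
Unset Strict Implicit.
Unset Printing Implicit Defensive.
Import Order.TTheory GRing.Theory Num.Theory.
Import numFieldTopology.Exports numFieldNormedType.Exports.
Local Open Scope classical_set_scope.
Local Open Scope ring_scope.
Local Open Scope complex_scope.

(* A function on T^2 = (R/Z)^2 is encoded as a function on R * R that is      *)
(* 1-periodic in each variable; every trigonometric polynomial below is such  *)
(* a function by construction, and the supremum norm over T^2 is the          *)
(* supremum norm over R * R.                                                  *)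

Definition expi2pi (R : realType) (a : R) : R[i] :=
  cos (2 * pi * a) +i* sin (2 * pi * a).

Definition e2 (R : realType) (p : int * int) (z : R * R) : R[i] :=
  expi2pi (p.1%:~R * z.1 + p.2%:~R * z.2).

Definition trig2 (R : realType) : set (R * R -> R[i]) :=
  [set t | exists (s : seq (int * int)) (c : int * int -> R[i]),
     t = (fun z => \sum_(p <- s) c p * e2 p z)].

(* MathComp-Analysis integrates real functions only; a complex-valued         *)
(* integral is taken componentwise.                                           *)
Definition cintegral01 (R : realType) (f : R -> R[i]) : R[i] :=
  Rintegral lebesgue_measure `[0, 1] (fun x => complex.Re (f x)) +i*
  Rintegral lebesgue_measure `[0, 1] (fun x => complex.Im (f x)).

Definition fourier_coef (R : realType) (t : R * R -> R[i]) (p : int * int) :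
    R[i] :=
  cintegral01 (fun x => cintegral01 (fun y => t (x, y) * (e2 p (x, y))^*)).

Definition freq (R : realType) (t : R * R -> R[i]) : set (int * int) :=
  [set p | fourier_coef t p != 0].

Definition trig2_on (R : realType) (F : set (int * int)) :
    set (R * R -> R[i]) :=
  [set t | trig2 t /\ freq t `<=` F].

(* In R[i], [0 <= w] means that w is real and nonnegative.  "Positive" has to *)
(* be read as "nonnegative" in the comparison with [specfact2]: the latter    *)
(* always contains the zero polynomial, so equality fails for the strictly    *)
(* positive polynomials [spos2] (see [spos2_neq_specfact2]).  The strict      *)
(* variant that does hold follows from [propertyA]: see [propertyA_spos2].    *)
Definition pos2 (R : realType) (F : set (int * int)) : set (R * R -> R[i]) :=
  [set t | trig2_on F t /\ forall z, 0 <= t z].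

Definition spos2 (R : realType) (F : set (int * int)) : set (R * R -> R[i]) :=
  [set t | trig2_on F t /\ forall z, 0 < t z].

Definition sqmod2 (R : realType) (F : set (int * int)) :
    set (R * R -> R[i]) :=
  [set (fun z => `|t z| ^+ 2) | t in @trig2_on R F].

Definition sup_closure (R : realType) (S : set (R * R -> R[i])) :
    set (R * R -> R[i]) :=
  @closure {uniform (R * R)%type -> (R[i])^o} S.

Definition specfact2 (R : realType) (F : set (int * int)) :
    set (R * R -> R[i]) :=
  @trig2 R `&` sup_closure (sqmod2 F).

Definition diffset (F : set (int * int)) : set (int * int) :=
  [set a - b | a in F & b in F].

Definition propertyA (R : realType) (F : set (int * int)) : Prop :=
  @pos2 R (diffset F) = specfact2 F.

Definition strip (R : realType) (alpha beta : R) : set (int * int) :=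
  [set p | `|p.2%:~R - p.1%:~R * alpha| < beta].

Lemma strip0E (R : realType) (beta : R) :
  strip 0 beta = [set p | `|p.2%:~R : R| < beta].
Proof. by apply/funext => p; rewrite /strip /= mulr0 subr0. Qed.

Lemma sup_closureP (R : realType) (S : set (R * R -> R[i]))
    (f : R * R -> R[i]) :
  sup_closure S f <->
  forall e : R, 0 < e ->
    exists2 g, S g & forall z, `|f z - g z| < e%:C.
Proof.
split=> [Sf e e0|H B].
  have eC : 0 < e%:C by rewrite ltcR.
  have [|g [Sg]] := Sf [set g | forall z, `|f z - g z| < e%:C].
    apply/uniform_nbhs.
    exists [set p : (R[i])^o * (R[i])^o | ball p.1 e%:C p.2]; split.
      by exists e%:C.
    by move=> g + z => /(_ z I).
  by exists g.
move=> /uniform_nbhs[E [[e /= e0 eE] EB]].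
case: e e0 eE => a b; rewrite ltcE /= => /andP[/eqP b0 a0].
rewrite {}b0 => eE.
have [g Sg fg] := H a a0.
exists g; split=> //; apply: EB => z _.
exact: (eE (f z, g z) (fg z)).
Qed.

Lemma propertyA_spos2 (R : realType) (F : set (int * int)) :
  propertyA R F ->
  @spos2 R (diffset F) = specfact2 F `&` [set t | forall z, 0 < t z].
Proof.
move=> A; rewrite -A; apply/seteqP; split => t.
  by move=> [tF t0]; split; [split|] => // z; exact: ltW.
by move=> [[tF _] t0].
Qed.

Lemma cintegral01_eq0 (R : realType) (f : R -> R[i]) :
  (forall x, f x = 0) -> cintegral01 f = 0.
Proof.
move=> f0; rewrite /cintegral01.
rewrite (_ : (fun x => complex.Re _) = cst 0); last first.
  by apply/funext => x; rewrite f0.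
rewrite (_ : (fun x => complex.Im _) = cst 0); last first.
  by apply/funext => x; rewrite f0.
by rewrite /Rintegral integral0.
Qed.

Lemma spos2_neq_specfact2 (R : realType) (F : set (int * int)) :
  @spos2 R (diffset F) <> specfact2 F.
Proof.
move=> E.
have T0 : @trig2 R (fun=> 0).
  by exists [::], (fun=> 0); apply/funext => z; rewrite big_nil.
have S0 : @sqmod2 R F (fun=> 0).
  exists (fun=> 0); last first.
    by apply/funext => z; rewrite normr0 expr0n.
  split=> // p; case/negP; apply/eqP; apply: cintegral01_eq0 => x.
  by apply: cintegral01_eq0 => y; rewrite mul0r.
have U0 : @specfact2 R F (fun=> 0).
  split=> //; apply/sup_closureP => e e0.
  by exists (fun=> 0) => // z; rewrite subrr normr0 ltcR.
rewrite -E in U0; case: U0 => _ /(_ (0, 0)).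
by rewrite ltxx.
Qed.

(* Main.v *)
(* The inclusion of [specfact2] in [pos2] holds for every [F]: Fourier
   coefficients are bounded by the supremum norm, and nonnegativity is a closed
   condition.

   For the converse write [F = {|k| <= m}], so that [F - F = {|k| <= 2m}].  Given
   [t >= 0] and [tau > 0], for each [x] the polynomial [t(x, .) + tau] is the
   squared modulus of a polynomial [q_x] of degree [2m] in [e(y)] (Fejer-Riesz),
   with no zero in the closed disc and [q_x(0) > 0].  This outer factor depends
   continuously on [x]: if [|q|^2] and [|r|^2] are close on the circle, then
   [h = q / r] satisfies [|h|^2 ~ 1] there and, by the maximum principle,
   [h(0) ~ 1], so Parseval forces [h] to be close to [1].  The frequencies in [x]
   are unrestricted, so [x |-> q_x] may be replaced by a Fejer mean; shifting the
   frequencies in [y] by [-m] puts the result in [F]. *)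

Require Import Defs.
From mathcomp Require Import all_boot all_order all_algebra.
From mathcomp Require Import all_classical all_reals all_analysis.
From mathcomp Require Import zify ring lra complex.
Set Implicit Arguments.
Unset Strict Implicit.
Unset Printing Implicit Defensive.
Import Order.TTheory GRing.Theory Num.Theory.
Import numFieldTopology.Exports numFieldNormedType.Exports.
Local Open Scope classical_set_scope.
Local Open Scope ring_scope.
Local Open Scope complex_scope.

(** * The complex modulus as a real number *)

Section Modulus.
Variable R : realType.
Implicit Types z w : R[i].

(** The norm on [R[i]] is itself complex-valued; [cmod] moves it to [R], where the order is total
    and [lra] and [nra] apply. *)
Definition cmod z : R := complex.Re `|z|.

Lemma cmodE z : `|z| = (cmod z)%:C.
Proof. by rewrite /cmod normc_def. Qed.

Lemma cmod_ge0 z : 0 <= cmod z.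
Proof. by rewrite -ler0c -cmodE. Qed.

Lemma cmodM z w : cmod (z * w) = cmod z * cmod w.
Proof. by apply: complexI; rewrite rmorphM /= -!cmodE normrM. Qed.

Lemma cmodD z w : cmod (z + w) <= cmod z + cmod w.
Proof. by rewrite -lecR rmorphD /= -!cmodE ler_normD. Qed.

Lemma cmodN z : cmod (- z) = cmod z.
Proof. by rewrite /cmod normrN. Qed.

Lemma cmodB z w : cmod (z - w) <= cmod z + cmod w.
Proof. by rewrite -(cmodN w) cmodD. Qed.

Lemma cmod_distC z w : cmod (z - w) = cmod (w - z).
Proof. by rewrite -cmodN opprB. Qed.

Lemma cmodB_ge z w : cmod z - cmod w <= cmod (z - w).
Proof. by rewrite lerBlDr -{1}(subrK w z) cmodD. Qed.

Lemma cmod0 : cmod 0 = 0.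
Proof. by rewrite /cmod normr0. Qed.

Lemma cmod1 : cmod 1 = 1.
Proof. by rewrite /cmod normr1. Qed.

Lemma cmod_eq0 z : (cmod z == 0) = (z == 0).
Proof.
by rewrite -(normr_eq0 z) cmodE; apply/eqP/eqP => [->|/complexI].
Qed.

Lemma cmod_gt0 z : (0 < cmod z) = (z != 0).
Proof. by rewrite lt_def cmod_ge0 andbT cmod_eq0. Qed.

Lemma cmodX z n : cmod (z ^+ n) = cmod z ^+ n.
Proof. by apply: complexI; rewrite rmorphXn /= -!cmodE normrX. Qed.

Lemma cmodV z : cmod z^-1 = (cmod z)^-1.
Proof. by apply: complexI; rewrite fmorphV /= -!cmodE normfV. Qed.

Lemma cmodJ z : cmod z^*%R = cmod z.
Proof. by rewrite /cmod norm_conjC. Qed.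

Lemma cmodR (x : R) : 0 <= x -> cmod x%:C = x.
Proof. by move=> x0; rewrite /cmod ger0_norm // ler0c. Qed.

Lemma cmod_nat n : cmod n%:R = n%:R.
Proof. by rewrite -(rmorph_nat (real_complex R)) cmodR. Qed.

Lemma cmod_sum (I : Type) (r : seq I) (P : pred I) (f : I -> R[i]) :
  cmod (\sum_(i <- r | P i) f i) <= \sum_(i <- r | P i) cmod (f i).
Proof.
elim/big_ind2 : _ => //; first by rewrite cmod0.
by move=> z1 x1 z2 x2 h1 h2; apply: (le_trans (cmodD _ _)); exact: lerD.
Qed.

Lemma sqr_cmod z : z * z^* = (cmod z ^+ 2)%:C.
Proof. by rewrite -sqr_normc cmodE rmorphXn. Qed.

Lemma cmod_Re z : `|complex.Re z| <= cmod z.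
Proof. by rewrite -lecR -cmodE normc_ge_Re. Qed.

Lemma cmod_Im z : `|complex.Im z| <= cmod z.
Proof.
have i1 : cmod (Complex 0 1 : R[i]) = 1.
  by rewrite /cmod normc_def /= expr0n expr1n add0r sqrtr1.
have := cmod_Re (z * Complex 0 1).
by rewrite ReiNIm normrN cmodM i1 mulr1.
Qed.

End Modulus.

(** * The exponential as a parametrization of the unit circle *)

Section Exponential.
Variable R : realType.
Implicit Types a b : R.
Notation e := (@expi2pi R).

Lemma expi2piD a b : e (a + b) = e a * e b.
Proof.
rewrite /expi2pi mulrDr cosD sinD.
rewrite -[RHS]/(Complex (_ - _) (_ + _)); congr Complex.
by rewrite addrC.
Qed.

Lemma expi2pi0 : e 0 = 1.
Proof. by rewrite /expi2pi mulr0 cos0 sin0. Qed.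

Lemma expi2piJ a : (e a)^*%R = e (- a).
Proof. by rewrite /expi2pi mulrN cosN sinN. Qed.

Lemma cmod_expi2pi a : cmod (e a) = 1.
Proof. by rewrite /cmod normc_def /= cos2Dsin2 sqrtr1. Qed.

Lemma expi2pi_neq0 a : e a != 0.
Proof. by rewrite -cmod_gt0 cmod_expi2pi ltr01. Qed.

Lemma expi2piN a : e (- a) = (e a)^-1.
Proof.
apply: (mulIf (expi2pi_neq0 a)).
by rewrite -expi2piD addNr expi2pi0 mulVf // expi2pi_neq0.
Qed.

Lemma expi2piXn a n : e (n%:R * a) = e a ^+ n.
Proof.
elim: n => [|n IH]; first by rewrite mul0r expi2pi0.
by rewrite exprS -IH -expi2piD mulrS mulrDl mul1r.
Qed.

Lemma expi2piXz a (k : int) : e (k%:~R * a) = e a ^ k.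
Proof.
case: k => n; first by rewrite -pmulrn expi2piXn.
by rewrite NegzE mulrNz mulNr expi2piN -pmulrn expi2piXn.
Qed.

Lemma expi2pi_nat n : e n%:R = 1.
Proof.
suff e1 : e 1 = 1 by rewrite -[n%:R]mulr1 expi2piXn e1 expr1n.
by rewrite /expi2pi mulr1 mulr_natl cos2pi sin2pi.
Qed.

(** The real part is 1 - 2 sin(pi a)^2, and the sine is positive on the open interval. *)
Lemma expi2pi_neq1 a : 0 < a < 1 -> e a != 1.
Proof.
case/andP => a0 a1; have s0 : 0 < sin (pi * a).
  by apply: sin_gt0_pi; rewrite mulr_gt0 ?pi_gt0 //= gtr_pMr ?pi_gt0.
apply/eqP => /(congr1 (@complex.Re R)) /=.
rewrite -mulrA mulr_natl cos_mulr2n cos2sin2 => /eqP.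
have s20 : 0 < sin (pi * a) ^+ 2 by rewrite exprn_gt0.
by apply/negP; rewrite lt_eqF // -mulr_natl; lra.
Qed.

Lemma expi2pi_surj (z : R[i]) : cmod z = 1 -> exists a, z = e a.
Proof.
have p0 : (2 * pi : R) != 0 by rewrite mulf_neq0 // gt_eqF ?pi_gt0.
case: z => x y z1.
have xy : x ^+ 2 + y ^+ 2 = 1.
  move: z1; rewrite /cmod normc_def /= => z1.
  by rewrite -(sqr_sqrtr (addr_ge0 (sqr_ge0 x) (sqr_ge0 y))) z1 expr1n.
have x1 : -1 <= x <= 1.
  rewrite -ler_norml -(ler_pXn2r (n := 2)) ?nnegrE //.
  by rewrite real_normK ?num_real // expr1n -xy lerDl sqr_ge0.
have cx : cos (acos x) = x by rewrite acosK // in_itv.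
have sx : sin (acos x) = `|y|.
  by rewrite sin_acos // -xy addrAC subrr add0r sqrtr_sqr.
have [y0|y0] := leP 0 y.
  exists (acos x / (2 * pi)); rewrite /expi2pi mulrC divfK // cx sx.
  by rewrite ger0_norm.
exists (- (acos x / (2 * pi))); rewrite /expi2pi mulrN mulrC divfK //.
by rewrite cosN sinN cx sx ltr0_norm // opprK.
Qed.

Lemma cmod1_conj (z : R[i]) : cmod z = 1 -> z^*%R = z^-1.
Proof. by move=> /expi2pi_surj[a ->]; rewrite expi2piJ expi2piN. Qed.

Lemma dist_expXn (z w : R[i]) n : cmod z = 1 -> cmod w = 1 ->
  cmod (z ^+ n - w ^+ n) <= n%:R * cmod (z - w).
Proof.
move=> z1 w1; elim: n => [|n IH]; first by rewrite subrr cmod0 mul0r.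
have -> : z ^+ n.+1 - w ^+ n.+1 = z * (z ^+ n - w ^+ n) + (z - w) * w ^+ n.
  by rewrite mulrBr mulrBl -!exprS addrA subrK.
apply: (le_trans (cmodD _ _)); rewrite !cmodM cmodX z1 w1 expr1n mul1r mulr1.
by rewrite mulrS mulrDl mul1r addrC lerD2l.
Qed.

Lemma dist_expi2piMz a b (k : int) :
  cmod (e (k%:~R * a) - e (k%:~R * b)) <= `|k|%N%:R * cmod (e a - e b).
Proof.
rewrite !expi2piXz; case: k => n /=.
  exact: dist_expXn (cmod_expi2pi a) (cmod_expi2pi b).
rewrite NegzE /=.
(* On the circle inversion is conjugation, an isometry, so negative exponents reduce to positive
   ones. *)
have J c : (e c ^+ n.+1)^-1 = (e c ^+ n.+1)^*%R.
  by rewrite cmod1_conj // cmodX cmod_expi2pi expr1n.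
rewrite -!exprnN !J -rmorphB cmodJ.
exact: dist_expXn (cmod_expi2pi a) (cmod_expi2pi b).
Qed.

End Exponential.

(** * Coefficient bounds by sampling at roots of unity *)

Section RootsOfUnity.
Variable R : realType.
Notation e := (@expi2pi R).

Lemma expi2pi_int (k : int) : e k%:~R = 1.
Proof. by rewrite -[k%:~R]mulr1 expi2piXz (expi2pi_nat R 1) exp1rz. Qed.

(** This is a geometric sum of powers of z = e(k/n), where z^n = 1. The bound on [k] forces z != 1
    unless k = 0. *)
Lemma sum_expi2pi (n : nat) (k : int) : (`|k| < n)%N ->
  \sum_(j < n) e (k%:~R * (j%:R / n%:R)) = if k == 0 then n%:R else 0.
Proof.
move=> kn; have n0 : (n%:R : R) != 0.
  by rewrite pnatr_eq0 -lt0n (leq_ltn_trans _ kn).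
have [->|k0] := eqVneq k 0.
  under eq_bigr do rewrite mul0r expi2pi0.
  by rewrite sumr_const card_ord.
pose z := e (k%:~R / n%:R).
have zn : z ^+ n = 1 by rewrite -expi2piXn mulrC divfK // expi2pi_int.
have z1 : z != 1.
  have [kp km] : (forall m : nat, k = m%:Z -> z != 1) /\
      (forall m : nat, k = - m%:Z -> z != 1).
  - have H m : (0 < m < n)%N -> e (m%:R / n%:R) != 1.
      move=> /andP[m0 mn]; apply: expi2pi_neq1.
      have n00 : (0 : R) < n%:R by rewrite ltr0n (leq_ltn_trans _ mn).
      apply/andP; split; first by rewrite divr_gt0 // ltr0n.
      by rewrite ltr_pdivrMr // mul1r ltr_nat.
    split=> m km; move: kn k0; rewrite /z km.
      by rewrite eqz_nat absz_nat -lt0n => mn m0; apply: H; rewrite m0.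
    rewrite oppr_eq0 abszN eqz_nat absz_nat -lt0n => mn m0.
    by rewrite mulrNz mulNr expi2piN invr_eq1; apply: H; rewrite m0.
  by case: (k) kp km => p kp km; [exact: (kp p)|exact: (km p.+1)].
have -> : \sum_(j < n) e (k%:~R * (j%:R / n%:R)) = \sum_(j < n) z ^+ j.
  by apply: eq_bigr => j _; rewrite -expi2piXn; congr e; rewrite mulrCA.
apply/eqP; rewrite -(mulrI_eq0 _ (@lregP _ (z - 1) _)) ?subr_eq0 //.
by rewrite -subrX1 zn subrr.
Qed.

(** Averaging against e(-kt) over the [n]th roots of unity isolates frequency [k] exactly, once [n]
    exceeds every |f i - k|; no integral is involved. Frequencies may repeat along [r], so the
    coefficient is itself a sum. *)
Lemma coef_le_sup (I : eqType) (r : seq I) (a : I -> R[i]) (f : I -> int)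
    (B : R) (k : int) :
  (forall t : R, cmod (\sum_(i <- r) a i * e ((f i)%:~R * t)) <= B) ->
  cmod (\sum_(i <- r | f i == k) a i) <= B.
Proof.
move=> bnd; pose n := (\max_(i <- r) `|(f i - k)%R|%N).+1.
have n0 : (0 : R) < n%:R by rewrite ltr0n.
have E : n%:R * (\sum_(i <- r | f i == k) a i) =
    \sum_(j < n) e (- k%:~R * (j%:R / n%:R)) *
      \sum_(i <- r) a i * e ((f i)%:~R * (j%:R / n%:R)).
  under [RHS]eq_bigr do rewrite mulr_sumr.
  rewrite [RHS]exchange_big /= [LHS]mulr_sumr [LHS]big_mkcond /=.
  apply: eq_big_seq => i ir.
  have fk : (`|(f i - k)%R| < n)%N.
    rewrite ltnS.
    exact: (@leq_bigmax_seq _ r xpredT (fun i => `|(f i - k)%R|%N) i ir).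
  have := sum_expi2pi fk; rewrite subr_eq0 => S.
  transitivity (a i * (if f i == k then n%:R else 0)).
    by case: eqP => _; rewrite ?mulr0 // mulrC.
  rewrite -S mulr_sumr; apply: eq_bigr => j _.
  rewrite [RHS]mulrCA -expi2piD; congr (_ * e _).
  by rewrite -mulrDl addrC intrD intrN.
rewrite -(ler_pM2l n0) -{1}(cmod_nat R n) -cmodM E.
apply: (le_trans (cmod_sum _ _ _)).
apply: (@le_trans _ _ (\sum_(j < n) B)).
  by apply: ler_sum => j _; rewrite cmodM cmod_expi2pi mul1r.
by rewrite sumr_const card_ord mulr_natl.
Qed.

Lemma coef2_le_sup (I : eqType) (r : seq I) (a : I -> R[i])
    (f : I -> int * int) (B : R) (k : int * int) :
  (forall z, cmod (\sum_(i <- r) a i * e2 (f i) z) <= B) ->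
  cmod (\sum_(i <- r | f i == k) a i) <= B.
Proof.
move=> bnd.
under eq_bigl do rewrite -pair_eqE /=.
rewrite big_mkcondr -big_filter -big_mkcond /=.
apply: coef_le_sup => y; rewrite big_filter.
apply: coef_le_sup => x.
have := bnd (x, y); rewrite /e2 /=.
by under eq_bigr do rewrite addrC expi2piD mulrA.
Qed.

Lemma expi2piX_mulJ (a : R) (k l : nat) :
  e a ^+ k * (e a ^+ l)^* = e ((k%:Z - l%:Z)%:~R * a).
Proof.
rewrite -!expi2piXn expi2piJ -expi2piD intrB -!pmulrn.
by rewrite -mulNr -mulrDl.
Qed.

(** Differences of exponents stay below [n] in absolute value, so the characters are exactly
    orthogonal on the [n]th roots of unity. *)
Lemma parseval (p : {poly R[i]}) n : (size p <= n)%N ->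
  \sum_(j < n) cmod p.[e (j%:R / n%:R)] ^+ 2 =
  n%:R * \sum_(k < n) cmod p`_k ^+ 2.
Proof.
move=> pn; apply: complexI; rewrite rmorphM rmorph_nat !rmorph_sum /=.
under eq_bigr => j _.
  rewrite -sqr_cmod !(horner_coef_wide _ pn) rmorph_sum big_distrlr /=.
  under eq_bigr => k _.
    under eq_bigr => l _.
      rewrite rmorphM mulrACA expi2piX_mulJ.
      over.
    over.
  over.
rewrite exchange_big mulr_sumr; apply: eq_bigr => k _ /=.
rewrite exchange_big /= (bigD1 k) //= [X in _ + X]big1 ?addr0.
  rewrite -mulr_sumr -sqr_cmod mulrC; congr (_ * _).
  under eq_bigr do rewrite subrr mul0r expi2pi0.
  by rewrite sumr_const card_ord.
move=> l lk; rewrite -mulr_sumr.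
rewrite sum_expi2pi; last by have := ltn_ord k; have := ltn_ord l; lia.
rewrite subr_eq0 eqz_nat ifN ?mulr0 //.
by rewrite eq_sym -(inj_eq val_inj) in lk.
Qed.

Lemma sum_coef_le_sup (p : {poly R[i]}) (B : R) n :
  (forall z, cmod z = 1 -> cmod p.[z] <= B) ->
  \sum_(k < n) cmod p`_k ^+ 2 <= B ^+ 2.
Proof.
move=> bnd; pose m := (maxn n (size p)).+1.
have pm : (size p <= m)%N by rewrite leqW // leq_maxr.
have m0 : (0 : R) < m%:R by rewrite ltr0n.
have nm : (n <= m)%N by rewrite leqW // leq_maxl.
apply: (@le_trans _ _ (\sum_(k < m) cmod p`_k ^+ 2)).
  rewrite (big_ord_widen _ (fun k : nat => cmod p`_k ^+ 2) nm) big_mkcond.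
  by apply: ler_sum => k _; case: ifP => // _; exact: sqr_ge0.
rewrite -(ler_pM2l m0) -parseval //.
apply: (@le_trans _ _ (\sum_(j < m) B ^+ 2)).
  apply: ler_sum => j _; rewrite ler_pXn2r ?nnegrE ?cmod_ge0 ?bnd ?cmod_expi2pi //.
  exact: le_trans (cmod_ge0 _) (bnd _ (cmod_expi2pi 0)).
by rewrite sumr_const card_ord mulr_natl.
Qed.

Lemma poly_coef_le_sup (p : {poly R[i]}) (B : R) k :
  (forall z, cmod z = 1 -> cmod p.[z] <= B) -> cmod p`_k <= B.
Proof.
move=> bnd; have B0 : 0 <= B.
  by rewrite (le_trans (cmod_ge0 _) (bnd _ (cmod_expi2pi 0))).
have := sum_coef_le_sup k.+1 bnd; rewrite big_ord_recr /= => H.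
rewrite -(ler_pXn2r (n := 2)) ?nnegrE ?cmod_ge0 //.
by apply: le_trans H; rewrite lerDr sumr_ge0 // => i _; exact: sqr_ge0.
Qed.

Lemma eq_poly_circle (p q : {poly R[i]}) :
  (forall z, cmod z = 1 -> p.[z] = q.[z]) -> p = q.
Proof.
move=> pq; apply/polyP => k; apply/eqP; rewrite -subr_eq0 -cmod_eq0 -coefB.
rewrite eq_le cmod_ge0 andbT; apply: poly_coef_le_sup => z z1.
by rewrite hornerD hornerN pq // subrr cmod0.
Qed.

End RootsOfUnity.

(** * Outer polynomials and Fejer-Riesz factorization *)

Section FejerRiesz.
Variable R : realType.
Implicit Types p q u : {poly R[i]}.

(* A polynomial with no zero in the closed unit disc is one whose inverse is a
   uniform limit of polynomials on the circle; only the latter is needed. *)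
Definition outer q := forall th : R, 0 < th -> exists u, forall z : R[i],
  cmod z = 1 -> cmod (q.[z] * u.[z] - 1) <= th.

Lemma outerC (c : R[i]) : c != 0 -> outer c%:P.
Proof.
(* The inverse of a nonzero constant is itself a polynomial, so the error is zero. *)
move=> c0 th th0; exists (c^-1)%:P => z _.
by rewrite !hornerC divff // subrr cmod0 ltW.
Qed.

Lemma outerM p q : outer p -> outer q -> outer (p * q).
Proof.
(* The error of the product is a + b + ab; with |a|, |b| <= t <= 1 it is at most 3t. *)
move=> op oq th th0; pose t := Num.min (th / 3) 1.
have t0 : 0 < t by rewrite lt_min ltr01 divr_gt0.
have t1 : t <= 1 by rewrite ge_min lexx orbT.
have t3 : t <= th / 3 by rewrite ge_min lexx.
have [u hu] := op t t0; have [v hv] := oq t t0.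
exists (u * v) => z z1; rewrite !hornerM.
set a := p.[z] * u.[z] - 1; set b := q.[z] * v.[z] - 1.
have -> : p.[z] * q.[z] * (u.[z] * v.[z]) - 1 = a + b + a * b.
  by rewrite /a /b; ring.
have ha : cmod a <= t := hu z z1; have hb : cmod b <= t := hv z z1.
have := cmod_ge0 a; have := cmod_ge0 b.
have := cmodD (a + b) (a * b); have := cmodD a b; rewrite cmodM; nra.
Qed.

(** The approximate inverse is a partial sum of the geometric series of 1 / (X - a) in X / a; the
    error on the circle is |a|^-K. *)
Lemma outerXsubC (a : R[i]) : 1 < cmod a -> outer ('X - a%:P).
Proof.
move=> a1 th th0.
have a0 : a != 0 by rewrite -cmod_gt0 (lt_trans ltr01).
have y1 : `|(cmod a)^-1| < 1.
  by rewrite ger0_norm ?invr_ge0 ?cmod_ge0 // invf_lt1 // (lt_trans ltr01).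
have /cvgrPdist_le/(_ _ th0)[K _ hK] := cvg_expr y1.
exists ((- a^-1)%:P * \sum_(k < K) (a^-1 *: 'X) ^+ k) => z z1.
have -> : ('X - a%:P).[z] * ((- a^-1)%:P * \sum_(k < K) (a^-1 *: 'X) ^+ k).[z] - 1
   = - (a^-1 * z) ^+ K.
  rewrite hornerM hornerC hornerXsubC horner_sum.
  under eq_bigr do rewrite horner_exp hornerZ hornerX.
  rewrite mulrA (_ : (z - a) * - a^-1 = - (a^-1 * z - 1)).
    by rewrite mulNr -subrX1; ring.
  by rewrite mulrN mulrBl divff // mulrC.
rewrite cmodN cmodX cmodM cmodV z1 mulr1.
by apply: le_trans (ler_norm _) _; rewrite -normrN -sub0r; exact: hK (leqnn K).
Qed.

(** Otherwise q u - 1 would have constant coefficient -1, although its coefficients are bounded by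
    its supremum on the circle. *)
Lemma outer_coef0_neq0 q : outer q -> q`_0 != 0.
Proof.
move=> oq; have [|u hu] := oq (1 / 2); first by lra.
apply/eqP => q0.
have : cmod (q * u - 1)`_0 <= 1 / 2.
  by apply: poly_coef_le_sup => z z1; rewrite hornerD hornerM hornerN hornerC hu.
by rewrite coefB coef0M q0 mul0r coef1 sub0r cmodN cmod1; lra.
Qed.

(** Since w^-d p(w) is real on the circle, p(w) equals w^(2d) times the conjugate of p(w) there. The
    latter is the polynomial with reversed conjugated coefficients, and polynomials are determined
    by their values on the circle. *)
Lemma selfreciprocal_coef d p : (size p <= d.*2.+1)%N ->
  (forall w, cmod w = 1 -> 0 < w ^- d * p.[w]) ->
  forall k, (k <= d.*2)%N -> p`_k = (p`_(d.*2 - k))^*%R.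
Proof.
move=> sp pos k kd.
suff E : p = \poly_(i < d.*2.+1) (p`_(d.*2 - i))^*%R.
  by rewrite [in LHS]E coef_poly ltnS kd.
apply: eq_poly_circle => w w1; rewrite horner_poly.
have w0 : w != 0 by rewrite -cmod_gt0 w1 ltr01.
have re : (w ^- d * p.[w])^*%R = w ^- d * p.[w].
  by apply/CrealP; rewrite realE ltW ?pos.
transitivity (w ^+ d.*2 * (p.[w])^*%R).
  have : w ^+ d * (p.[w])^*%R = w ^- d * p.[w].
    rewrite -[RHS]re rmorphM rmorphV ?unitfE ?expf_neq0 // rmorphXn /=.
    by rewrite (cmod1_conj w1) exprVn invrK.
  rewrite -addnn exprD -mulrA => ->.
  by rewrite mulrA divff ?mul1r // expf_neq0.
rewrite (horner_coef_wide _ sp) rmorph_sum mulr_sumr.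
rewrite (reindex_inj rev_ord_inj) /=; apply: eq_bigr => i _.
rewrite subSS rmorphM rmorphXn /= (cmod1_conj w1) mulrCA; congr (_ * _).
have iD : (i <= d.*2)%N by rewrite -ltnS.
by rewrite -[in w ^+ d.*2](subnKC iD) exprD exprVn mulrK // unitfE expf_neq0.
Qed.

Lemma selfreciprocal_root d p (a : R[i]) : (size p <= d.*2.+1)%N ->
  (forall w, cmod w = 1 -> 0 < w ^- d * p.[w]) ->
  a != 0 -> root p a -> root p (a^*%R)^-1.
Proof.
move=> sp pos a0 /rootP pa; apply/rootP.
have c0 : a^*%R != 0 by rewrite conjC_eq0.
apply: (mulfI (expf_neq0 d.*2 c0)); rewrite mulr0 -conjC0 -pa.
rewrite !(horner_coef_wide _ sp) rmorph_sum mulr_sumr.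
rewrite (reindex_inj rev_ord_inj) /=; apply: eq_bigr => i _.
have iD : (i <= d.*2)%N by rewrite -ltnS.
rewrite subSS rmorphM rmorphXn /= (selfreciprocal_coef sp pos) ?leq_subr //.
rewrite subKn // mulrCA; congr (_ * _).
by rewrite -[in _ ^+ d.*2](subnK iD) exprD exprVn mulrAC divff ?mul1r // expf_neq0.
Qed.

(** A pair of zeros symmetric about the circle contributes w |w - a|^2 up to a constant; this is the
    factor removed at each step of [fejer_riesz]. *)
Lemma circle_mulXsubC (a w : R[i]) : a != 0 -> cmod w = 1 ->
  (w - a) * (w - (a^*%R)^-1) =
  - (a^*%R)^-1 * (w * (cmod (w - a) ^+ 2)%:C).
Proof.
move=> a0 w1; have c0 : a^*%R != 0 by rewrite conjC_eq0.
have w0 : w != 0 by rewrite -cmod_gt0 w1 ltr01.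
rewrite -sqr_cmod rmorphB /= (cmod1_conj w1).
by field; rewrite w0 c0.
Qed.

(** Induction on [d], removing a pair of symmetric zeros at a time. Only the zero outside the closed
    disc is passed to [q], which keeps [q] outer. *)
Lemma fejer_riesz d p : (size p <= d.*2.+1)%N ->
  (forall w, cmod w = 1 -> 0 < w ^- d * p.[w]) ->
  exists q, [/\ (size q <= d.+1)%N, outer q &
    forall w, cmod w = 1 -> p.[w] = w ^+ d * (cmod q.[w] ^+ 2)%:C].
Proof.
elim: d p => [|d IH] p sp pos.
  have [c pE] : exists c, p = c%:P.
    by exists p`_0; apply: size1_polyC; rewrite (leq_trans sp).
  have c0 : 0 < c.
    by have := pos 1 (cmod1 _); rewrite pE hornerC expr0 invr1 mul1r.
  exists (sqrtc c)%:P; split.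
  - exact: size_polyC_leq1.
  - by apply: outerC; rewrite sqrtc_eq0 gt_eqF.
  - move=> w w1; rewrite pE !hornerC expr0 mul1r -cmodX sqr_sqrtc -cmodE.
    by rewrite gtr0_norm.
have w0 w : cmod w = 1 -> w != 0 by move=> w1; rewrite -cmod_gt0 w1 ltr01.
have sc := selfreciprocal_coef sp pos.
(* If the constant coefficient vanishes, so does the top one by symmetry; dividing by X then lowers
   the size bound by two. *)
have [p0|p0] := eqVneq p`_0 0.
  have ptop : p`_(d.+1.*2) = 0 by rewrite sc // subnn p0 conjC0.
  have /factor_theorem[p1 pE] : root p 0 by apply/rootP; rewrite horner_coef0.
  rewrite subr0 in pE.
  have sp1 : (size p1 <= d.*2.+1)%N.
    have : (size p <= d.+1.*2)%N.
      apply/leq_sizeP => j; rewrite leq_eqVlt => /predU1P[<-//|jd].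
      by move/leq_sizeP: sp; apply.
    have [->|p10] := eqVneq p1 0; first by rewrite size_poly0.
    by rewrite pE size_mulX // doubleS ltnS.
  have pw w : p.[w] = w * p1.[w] by rewrite pE hornerM hornerX mulrC.
  have [w w1|q [sq oq qE]] := IH p1 sp1.
    have := pos w w1; rewrite pw exprS invfM mulrCA mulrA mulrA mulfV ?w0 //.
    by rewrite mul1r.
  exists q; split => //; first exact: leqW.
  by move=> w w1; rewrite pw qE // (exprS w) mulrA.
have szp : size p = d.+1.*2.+1.
  apply/eqP; rewrite eqn_leq sp ltnNge; apply/negP => /leq_sizeP/(_ _ (leqnn _)).
  by move: p0; rewrite sc // subn0 => /eqP + /(congr1 Num.conj); rewrite conjC0.
have [a pa] : exists a, root p a.
  by apply/closed_rootP; rewrite szp.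
have a0 : a != 0.
  by apply: contra p0 => /eqP a0; move: pa; rewrite a0 rootE horner_coef0.
have off b : root p b -> cmod b != 1.
  by move=> /rootP pb; apply/eqP => /pos; rewrite pb mulr0 ltxx.
(* Strict positivity excludes zeros on the circle, and reflecting a zero inside the disc gives one
   outside. *)
wlog a1 : a pa a0 / 1 < cmod a.
  move=> H; have := off a pa; rewrite neq_lt => /orP[a1|a1]; last exact: (H a).
  apply: (H (a^*%R)^-1); first exact: selfreciprocal_root sp pos a0 pa.
    by rewrite invr_eq0 conjC_eq0.
  by rewrite cmodV cmodJ invf_gt1 // cmod_gt0.
pose b := (a^*%R)^-1.
have pb : root p b by exact: selfreciprocal_root sp pos a0 pa.
have ba : b != a.
  apply/eqP => ba; have : cmod b < 1.
    by rewrite cmodV cmodJ invf_lt1 // (lt_trans ltr01).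
  by rewrite ba ltNge ltW.
have /factor_theorem[p1 pE1] := pa.
have /factor_theorem[p2 pE2] : root p1 b.
  by move: pb; rewrite pE1 rootM root_XsubC (negPf ba) orbF.
(* The scalar is the constant of [circle_mulXsubC]; with it the positivity hypothesis passes from
   [p] to [p3]. *)
pose p3 := - b *: p2.
have b0 : b != 0 by rewrite invr_eq0 conjC_eq0.
have pw w : cmod w = 1 -> p.[w] = w * (cmod (w - a) ^+ 2)%:C * p3.[w].
  move=> w1; rewrite pE1 pE2 !hornerM !hornerXsubC -mulrA [_ * (w - a)]mulrC.
  by rewrite circle_mulXsubC // hornerZ mulrCA [RHS]mulrC mulrA mulrAC.
have n0 w : cmod w = 1 -> 0 < (cmod (w - a) ^+ 2)%:C.
  move=> w1; rewrite ltcR exprn_gt0 // cmod_gt0 subr_eq0.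
  by apply/eqP => wa; move: a1; rewrite -wa w1 ltxx.
have sp3 : (size p3 <= d.*2.+1)%N.
  rewrite size_scale ?oppr_eq0 //.
  have p20 : p2 != 0.
    by apply/eqP => p20; move: szp; rewrite pE1 pE2 p20 !mul0r size_poly0.
  have p10 : p1 != 0.
    by apply/eqP => p10; move: szp; rewrite pE1 p10 !mul0r size_poly0.
  move: szp; rewrite pE1 size_Mmonic ?monicXsubC // pE2 size_Mmonic ?monicXsubC //.
  by rewrite !size_XsubC !addnS !addn0 /= doubleS => -[->].
have [w w1|q [sq oq qE]] := IH p3 sp3.
  have E : w ^- d.+1 * p.[w] = (cmod (w - a) ^+ 2)%:C * (w ^- d * p3.[w]).
    rewrite pw // (exprS w) invfM; move: (w ^- d) (_%:C) => A B.
    by field; exact: w0.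
  have := pos w w1; rewrite E.
  by rewrite pmulr_rgt0 // n0.
exists (('X - a%:P) * q); split.
- have [->|q0] := eqVneq q 0; first by rewrite mulr0 size_poly0.
  by rewrite size_monicM ?monicXsubC // size_XsubC.
- by apply: outerM => //; exact: outerXsubC.
- move=> w w1.
  rewrite pw // qE // hornerM hornerXsubC cmodM exprMn rmorphM (exprS w) /=.
  by ring.
Qed.

End FejerRiesz.

(** * Continuity of the outer factor in its modulus *)

Section OuterContinuity.
Variable R : realType.
Implicit Types p q r u : {poly R[i]}.

(** Let [th] tend to 0. The range stops at 1/2 so that 1 - th stays away from 0 in the
    applications. *)
Lemma le_of_le_addMr (x y D : R) :
  (forall th, 0 < th <= 1 / 2 -> x <= y + th * D) -> x <= y.
Proof.
move=> H; apply/ler_addgt0Pr => eps eps0.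
have D0 : 0 < `|D| + 1 by rewrite ltr_wpDl.
pose th := Num.min (1 / 2) (eps / (`|D| + 1)).
have th0 : 0 < th by rewrite lt_min divr_gt0 // divr_gt0 // ltr01.
have th1 : th <= 1 / 2 by rewrite ge_min lexx.
have thD : th * (`|D| + 1) <= eps by rewrite -ler_pdivlMr // ge_min lexx orbT.
have := H th; rewrite th0 th1 => /(_ isT); have := ler_norm D; nra.
Qed.

(** This is the maximum principle for p / q at 0. If [v] approximates 1 / q, the polynomial p v is
    at most B (1 + th) on the circle, hence so is its constant coefficient, while q(0) v(0) is
    within [th] of 1. *)
Lemma outer_max q p (B : R) : outer q -> 0 <= B ->
  (forall z, cmod z = 1 -> cmod p.[z] <= B * cmod q.[z]) ->
  cmod p`_0 <= B * cmod q`_0.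
Proof.
move=> oq B0 pq.
apply: (@le_of_le_addMr _ _ (cmod p`_0 + B * cmod q`_0)) => th /andP[th0 th1].
have [v hv] := oq th th0.
have h1 : cmod (q`_0 * v`_0 - 1) <= th.
  have <- : (q * v - 1)`_0 = q`_0 * v`_0 - 1 by rewrite coefB coef0M coef1.
  by apply: poly_coef_le_sup => z z1; rewrite hornerD hornerM hornerN hornerC hv.
have h2 : cmod (p`_0 * v`_0) <= B * (1 + th).
  rewrite -coef0M; apply: poly_coef_le_sup => z z1; rewrite hornerM cmodM.
  apply: (@le_trans _ _ (B * cmod (q.[z] * v.[z]))).
    by rewrite cmodM mulrA ler_wpM2r ?cmod_ge0 ?pq.
  rewrite ler_wpM2l // -lerBlDl -{1}(cmod1 R).
  by apply: le_trans (cmodB_ge _ _) (hv z z1).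
have h3 : 1 - th <= cmod q`_0 * cmod v`_0.
  rewrite -cmodM lerBlDr -lerBlDl -{1}(cmod1 R).
  by apply: le_trans (cmodB_ge _ _) _; rewrite cmod_distC.
rewrite cmodM in h2.
have := ler_wpM2l (cmod_ge0 p`_0) h3; have := ler_wpM2l (cmod_ge0 q`_0) h2.
nra.
Qed.

(* If [f] is analytic in the disc and [|f| <= C] on the circle, then Parseval
   bounds the [L^2] norm of [f - f(0)] by [C^2 - |f(0)|^2]; here [f = q / r],
   with [1 / r] replaced by a polynomial approximation. *)
Lemma outer_energy r q (B C : R) (rho : R[i]) k : outer r -> 0 <= C ->
  q`_0 = rho * r`_0 ->
  (forall z, cmod z = 1 -> cmod q.[z] <= C * cmod r.[z]) ->
  (forall z, cmod z = 1 -> cmod r.[z] <= B) ->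
  cmod (q`_k - rho * r`_k) ^+ 2 <= B ^+ 2 * (C ^+ 2 - cmod rho ^+ 2).
Proof.
move=> outr C0 q0 qr rB; pose g := q - rho *: r.
have -> : q`_k - rho * r`_k = g`_k by rewrite coefB coefZ.
pose N := cmod rho; have N0 : 0 <= N := cmod_ge0 rho.
have X0 : 0 <= cmod g`_k ^+ 2 by exact: sqr_ge0.
(* The first term of the error comes from (1 - th)^2 >= 1 - 2 th, the second from expanding T^2
   below. *)
apply: (@le_of_le_addMr _ _ (2 * cmod g`_k ^+ 2 +
  B ^+ 2 * (2 * C * (C + N) + (C + N) ^+ 2))) => th /andP[th0 th1].
have [u hu] := outr th th0.
(* [h] stands for q / r; the correction, of size at most |rho| th on the circle, makes its constant
   coefficient exactly [rho]. *)
pose h := q * u - rho *: (r * u - 1).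
have hE : h = g * u + rho%:P.
  by rewrite /h /g -!mul_polyC; ring.
pose T := C * (1 + th) + N * th.
pose m := (maxn (maxn (size g) (size (g * u))) k).
have sh : \sum_(i < m.+1) cmod h`_i ^+ 2 <= T ^+ 2.
  apply: sum_coef_le_sup => z z1.
  rewrite /h !(hornerD, hornerN, hornerM, hornerZ, hornerC).
  apply: le_trans (cmodB _ _) _; rewrite lerD //; last first.
    by rewrite cmodM ler_wpM2l // hu.
  apply: (@le_trans _ _ (C * cmod (r.[z] * u.[z]))).
    by rewrite !cmodM mulrA ler_wpM2r ?cmod_ge0 ?qr.
  rewrite ler_wpM2l // -lerBlDl -{1}(cmod1 R).
  by apply: le_trans (cmodB_ge _ _) (hu z z1).
have g0 : (g * u)`_0 = 0 by rewrite coef0M coefB coefZ q0 subrr mul0r.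
have sgu : \sum_(i < m.+1) cmod (g * u)`_i ^+ 2 <= T ^+ 2 - N ^+ 2.
  rewrite lerBrDr; apply: le_trans sh.
  rewrite !big_ord_recl /= g0 hE coefD g0 coefC eqxx add0r cmod0 expr0n add0r.
  rewrite addrC lerD2l; apply: ler_sum => i _.
  by rewrite coefD coefC addr0.
(* Pointwise (1 - th) |g| <= |r u| |g| <= B |g u|; [parseval] transfers this to the coefficients. *)
have sg : (1 - th) ^+ 2 * \sum_(i < m.+1) cmod g`_i ^+ 2 <=
    B ^+ 2 * \sum_(i < m.+1) cmod (g * u)`_i ^+ 2.
  have m0 : (0 : R) < m.+1%:R by rewrite ltr0n.
  have szg : (size g <= m.+1)%N by rewrite leqW // /m !leq_max leqnn.
  have szgu : (size (g * u)%R <= m.+1)%N.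
    by rewrite leqW // /m !leq_max leqnn orbT.
  rewrite -(ler_pM2l m0) mulrCA [leRHS]mulrCA -(parseval szg) -(parseval szgu).
  rewrite !mulr_sumr; apply: ler_sum => j _.
  set z := expi2pi _; have z1 : cmod z = 1 := cmod_expi2pi _.
  rewrite -!exprMn ler_pXn2r ?nnegrE ?mulr_ge0 ?cmod_ge0 ?subr_ge0 //; last 2 first.
  - by lra.
  - exact: le_trans (cmod_ge0 _) (rB z z1).
  rewrite hornerM cmodM.
  have h1 : 1 - th <= cmod r.[z] * cmod u.[z].
    rewrite -cmodM lerBlDr -lerBlDl -{1}(cmod1 R).
    by apply: le_trans (cmodB_ge _ _) _; rewrite cmod_distC hu.
  have h2 : cmod r.[z] * cmod u.[z] <= B * cmod u.[z].
    by rewrite ler_wpM2r ?cmod_ge0 ?rB.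
  by rewrite mulrC mulrCA ler_wpM2l ?cmod_ge0 // (le_trans h1).
have gk : cmod g`_k ^+ 2 <= \sum_(i < m.+1) cmod g`_i ^+ 2.
  have km : (k < m.+1)%N by rewrite ltnS leq_maxr.
  rewrite (bigD1 (Ordinal km)) //= lerDl sumr_ge0 // => i _; exact: sqr_ge0.
have e1 : (1 - th) ^+ 2 * cmod g`_k ^+ 2 <= B ^+ 2 * (T ^+ 2 - N ^+ 2).
  apply: le_trans (ler_wpM2l (sqr_ge0 _) gk) _.
  by apply: le_trans sg _; rewrite ler_wpM2l ?sqr_ge0.
have e2 : T ^+ 2 <= C ^+ 2 + th * (2 * C * (C + N) + (C + N) ^+ 2).
  rewrite -subr_ge0 (_ : _ - _ = th * (1 - th) * (C + N) ^+ 2); last first.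
    by rewrite /T; ring.
  by rewrite mulr_ge0 ?sqr_ge0 // mulr_ge0 ?subr_ge0; lra.
have e3 := ler_wpM2l (sqr_ge0 B) (lerB e2 (lexx (N ^+ 2))).
have e4 : 0 <= th ^+ 2 * cmod g`_k ^+ 2 by rewrite mulr_ge0 ?sqr_ge0.
by move: (le_trans e1 e3) e4; clear; lra.
Qed.

(** Put rho = q(0) / r(0), a positive real because both constant coefficients are positive. Applying
    [outer_max] both ways puts [rho] within [kap] of 1, and [outer_energy] then controls q - rho r.
    The constant 10 is 2 * 4 + 2, from squaring a sum of two errors. *)
Lemma outer_close q r (B kap : R) k : outer q -> outer r ->
  0 < q`_0 -> 0 < r`_0 -> 0 <= kap <= 1 ->
  (forall z, cmod z = 1 ->
    [/\ cmod q.[z] ^+ 2 <= (1 + kap) * cmod r.[z] ^+ 2,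
        cmod r.[z] ^+ 2 <= (1 + kap) * cmod q.[z] ^+ 2 & cmod r.[z] <= B]) ->
  cmod (q`_k - r`_k) ^+ 2 <= 10 * B ^+ 2 * kap.
Proof.
move=> oq outr q0 r0 /andP[k0 k1] H; pose C := 1 + kap.
have C1 : 1 <= C by rewrite /C; lra.
(* Replacing the square root of [C] by [C] costs nothing essential, since C >= 1. *)
have CM (x y : R) : 0 <= x -> 0 <= y -> x ^+ 2 <= C * y ^+ 2 -> x <= C * y.
  move=> x0 y0 xy; rewrite -(ler_pXn2r (n := 2)) ?nnegrE ?mulr_ge0 //; last lra.
  apply: le_trans xy _; rewrite exprMn ler_wpM2r ?sqr_ge0 //.
  by rewrite expr2 ler_peMl // (le_trans ler01).
have qr z : cmod z = 1 -> cmod q.[z] <= C * cmod r.[z].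
  by move=> z1; have [h _ _] := H z z1; apply: CM => //; exact: cmod_ge0.
have rq z : cmod z = 1 -> cmod r.[z] <= C * cmod q.[z].
  by move=> z1; have [_ h _] := H z z1; apply: CM => //; exact: cmod_ge0.
have rB z : cmod z = 1 -> cmod r.[z] <= B by move=> /H[].
have B0 : 0 <= B by exact: le_trans (cmod_ge0 _) (rB 1 (cmod1 _)).
have r00 : 0 < cmod r`_0 by rewrite cmod_gt0 gt_eqF.
pose rho : R := cmod q`_0 / cmod r`_0.
have rho0 : 0 <= rho by rewrite divr_ge0 ?cmod_ge0.
have pE p : 0 < p`_0 -> p`_0 = (cmod p`_0)%:C.
  by move=> p0; rewrite -cmodE gtr0_norm.
have qE : q`_0 = rho%:C * r`_0.
  by rewrite [r`_0]pE // -rmorphM /= divfK ?gt_eqF // -pE.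
have C00 : 0 <= C by lra.
have M1 : rho <= C by rewrite ler_pdivrMr // outer_max.
have M2 : 1 <= C * rho by rewrite mulrA ler_pdivlMr // mul1r outer_max.
have E := outer_energy k outr C00 qE qr rB.
rewrite cmodR // in E.
have rk := poly_coef_le_sup k rB.
have rho1 : `|rho - 1| <= kap.
  rewrite ler_norml; apply/andP.
  by split; rewrite /C in M1 M2; clear -M1 M2 k0 k1 rho0; nra.
have D : cmod (q`_k - r`_k) <= cmod (q`_k - rho%:C * r`_k) + kap * B.
  have -> : q`_k - r`_k = (q`_k - rho%:C * r`_k) + (rho - 1)%:C * r`_k.
    by rewrite rmorphB /=; ring.
  apply: le_trans (cmodD _ _) _; rewrite lerD2l cmodM ler_pM ?cmod_ge0 //.
  by rewrite /cmod normc_def /= expr0n addr0 sqrtr_sqr.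
have E2 : C ^+ 2 - rho ^+ 2 <= 4 * kap.
  have : 1 - kap <= rho by move: rho1; rewrite ler_norml => /andP[]; lra.
  by rewrite /C; clear -k0 k1 rho0; nra.
have E3 := le_trans E (ler_wpM2l (sqr_ge0 B) E2).
move: D E3; set a := cmod (_ - _) => D; set b := cmod (_ - _) in D * => E3.
have a0 : 0 <= a := cmod_ge0 _.
have b0 : 0 <= b := cmod_ge0 _.
have D2 : a ^+ 2 <= (b + kap * B) ^+ 2.
  by rewrite ler_pXn2r ?nnegrE // addr_ge0 // mulr_ge0.
have D3 : (b + kap * B) ^+ 2 <= 2 * b ^+ 2 + 2 * (kap * B) ^+ 2.
  by have := sqr_ge0 (b - kap * B); clear; lra.
have D4 : (kap * B) ^+ 2 <= kap * B ^+ 2.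
  by rewrite exprMn ler_wpM2r ?sqr_ge0 // expr2 ler_piMl.
by move: (le_trans D2 D3) D4 E3; clear; lra.
Qed.

End OuterContinuity.

(** * Integrals of real trigonometric functions over a period *)

Section TrigIntegral.
Variable R : realType.
Notation mu := (@lebesgue_measure R).

(** With c = 2 pi k, this is the shape of the real and imaginary parts of a e(kx); the family is
    closed under antiderivatives when c != 0. *)
Let trig (A B c x : R) : R := A * cos (c * x) + B * sin (c * x).

Lemma is_derive_trig (A B c x : R) : c != 0 ->
  is_derive x 1 (trig (- B / c) (A / c) c) (trig A B c x).
Proof.
move=> c0; rewrite /trig.
have dl : is_derive x 1 (fun y : R => c * y) c.
  by apply: is_derive_eq; rewrite -[_ *: _]/(c * 1) mulr1.
have dc : is_derive x 1 (fun y => cos (c * y)) (- sin (c * x) * c).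
  by have := @is_derive1_comp R cos (fun y => c * y) x _ _ (is_derive_cos _) dl.
have ds : is_derive x 1 (fun y => sin (c * y)) (cos (c * x) * c).
  by have := @is_derive1_comp R sin (fun y => c * y) x _ _ (is_derive_sin _) dl.
apply: is_derive_eq.
rewrite -![_ *: _]/(_ * _); by field.
Qed.

Lemma continuous_trig (A B c : R) : continuous (trig A B c).
Proof.
move=> x; have cx : (fun y : R => c * y) @ x --> c * x.
  exact: mulrl_continuous.
apply: cvgD; apply: cvgM; try exact: cvg_cst.
  by apply: cvg_comp cx _; exact: continuous_cos.
by apply: cvg_comp cx _; exact: continuous_sin.
Qed.

Lemma integrable_trig (A B c : R) :
  mu.-integrable `[0, 1] (EFin \o trig A B c).
Proof.
apply: continuous_compact_integrable; first exact: segment_compact.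
by apply: continuous_subspaceT; exact: continuous_trig.
Qed.

Lemma Rintegral_trig (A B c : R) : c != 0 -> cos c = 1 -> sin c = 0 ->
  Rintegral mu `[0, 1] (trig A B c) = 0.
Proof.
move=> c0 cc sc; rewrite /Rintegral.
rewrite (@continuous_FTC2 _ _ (trig (- B / c) (A / c) c)) //=.
- by rewrite /trig mulr1 cc sc !mulr0 cos0 sin0 !mulr0 subrr.
- by apply: continuous_subspaceT; exact: continuous_trig.
- have dF x : derivable (trig (- B / c) (A / c) c) x 1.
    by case: (is_derive_trig A B x c0).
  have cF := @continuous_trig (- B / c) (A / c) c.
  split => [x _|//|]; first exact: dF.
    by apply: cvg_at_right_filter; exact: cF.
  by apply: cvg_at_left_filter; exact: cF.
- move=> x _; rewrite derive1E; by case: (is_derive_trig A B x c0).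
Qed.

End TrigIntegral.

(** * Fourier coefficients and normal forms of trigonometric polynomials *)

Section FourierCoefficients.
Variable R : realType.
Notation e := (@expi2pi R).
Notation mu := (@lebesgue_measure R).

(** Integrability is carried along with the value because additivity of the integral requires it. *)
Definition cintegral01_spec (f : R -> R[i]) (v : R[i]) :=
  [/\ mu.-integrable `[0, 1] (EFin \o (fun x => complex.Re (f x))),
      mu.-integrable `[0, 1] (EFin \o (fun x => complex.Im (f x))) &
      cintegral01 f = v].

Lemma cintegral01_spec0 : cintegral01_spec (fun=> 0) 0.
Proof.
have i0 : mu.-integrable `[0, 1] (EFin \o (fun=> 0 : R)).
  apply: (@continuous_compact_integrable R (fun=> 0)); first exact: segment_compact.
  by apply: continuous_subspaceT; exact: cst_continuous.
by split; last exact: cintegral01_eq0.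
Qed.

Lemma cintegral01_specD f g v w : cintegral01_spec f v ->
  cintegral01_spec g w -> cintegral01_spec (fun x => f x + g x) (v + w).
Proof.
move=> [fR fI <-] [gR gI <-].
have RE : (fun x => complex.Re (f x + g x)) =
    (fun x => complex.Re (f x) + complex.Re (g x)).
  by apply/funext => x; case: (f x) => a b; case: (g x).
have IE : (fun x => complex.Im (f x + g x)) =
    (fun x => complex.Im (f x) + complex.Im (g x)).
  by apply/funext => x; case: (f x) => a b; case: (g x).
rewrite /cintegral01_spec /cintegral01 RE IE; split.
- exact: (integrableD _ fR gR).
- exact: (integrableD _ fI gI).
- by rewrite !RintegralD.
Qed.

Lemma cintegral01_specZ (a : R[i]) (k : int) :
  cintegral01_spec (fun x => a * e (k%:~R * x)) (if k == 0 then a else 0).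
Proof.
pose c : R := 2 * pi * k%:~R.
have RE : (fun x : R => complex.Re (a * e (k%:~R * x))) =
    (fun x => complex.Re a * cos (c * x) + - complex.Im a * sin (c * x)).
  by apply/funext => x; rewrite /expi2pi /c mulrA mulNr; case: (a).
have IE : (fun x : R => complex.Im (a * e (k%:~R * x))) =
    (fun x => complex.Im a * cos (c * x) + complex.Re a * sin (c * x)).
  by apply/funext => x; rewrite /expi2pi /c mulrA addrC; case: (a).
rewrite /cintegral01_spec /cintegral01 RE IE.
split; [exact: integrable_trig|exact: integrable_trig|].
have [k0|k0] := eqVneq k 0.
  have cE : c = 0 by rewrite /c k0 mulr0.
  have cst_trig A B : (fun x : R => A * cos (c * x) + B * sin (c * x)) = fun=> A.
    by apply/funext => x; rewrite cE mul0r cos0 sin0 mulr0 mulr1 addr0.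
  rewrite !cst_trig.
  rewrite !Rintegral_cst //= lebesgue_measure_itv /= lte_fin ltr01 oppr0 adde0 /=.
  by rewrite !mulr1; case: (a).
have c0 : c != 0 by rewrite !mulf_neq0 ?intr_eq0 // gt_eqF ?pi_gt0.
have := expi2pi_int R k; rewrite /expi2pi -/c => -[cc sc].
by rewrite !Rintegral_trig.
Qed.

Lemma cintegral01_sum (I : Type) (r : seq I) (a : I -> R[i]) (f : I -> int) :
  cintegral01 (fun x => \sum_(i <- r) a i * e ((f i)%:~R * x)) =
  \sum_(i <- r | f i == 0) a i.
Proof.
suff [] : cintegral01_spec (fun x => \sum_(i <- r) a i * e ((f i)%:~R * x))
  (\sum_(i <- r | f i == 0) a i) by [].
elim: r => [|i r IH].
  by under eq_fun do rewrite big_nil; rewrite big_nil; exact: cintegral01_spec0.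
under eq_fun do rewrite big_cons.
rewrite big_mkcond big_cons -big_mkcond /=.
exact: cintegral01_specD (cintegral01_specZ _ _) IH.
Qed.

Lemma fourier_coef_sum (I : Type) (r : seq I) (a : I -> R[i])
    (f : I -> int * int) (p : int * int) :
  fourier_coef (fun z => \sum_(i <- r) a i * e2 (f i) z) p =
  \sum_(i <- r | f i == p) a i.
Proof.
rewrite /fourier_coef.
have E x y : (\sum_(i <- r) a i * e2 (f i) (x, y)) * (e2 p (x, y))^*%R =
  \sum_(i <- r) (a i * e (((f i).1 - p.1)%:~R * x)) * e (((f i).2 - p.2)%:~R * y).
  rewrite mulr_suml; apply: eq_bigr => i _.
  rewrite /e2 /= expi2piJ -!mulrA -!expi2piD !intrB; congr (_ * e _); ring.
under eq_fun => x.
  under eq_fun do rewrite E.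
  rewrite cintegral01_sum -big_filter.
  over.
rewrite cintegral01_sum big_filter_cond; apply: eq_bigl => i.
by rewrite !subr_eq0 andbC -pair_eqE.
Qed.

(** Lists of coefficient-frequency pairs may repeat a frequency, so sums become concatenations and
    products become lists of pairs. Conversely, coefficients of equal frequencies are collected. *)
Lemma trig2P (t : R * R -> R[i]) : trig2 t <->
  exists l : seq (R[i] * (int * int)), t = fun z => \sum_(x <- l) x.1 * e2 x.2 z.
Proof.
split => [[s [c ->]]|[l ->]].
  by exists [seq (c p, p) | p <- s]; apply/funext => z; rewrite big_map.
exists (undup (map snd l)), (fun p => \sum_(x <- l | x.2 == p) x.1).
apply/funext => z.
rewrite (eq_big_seq (fun x =>
    \sum_(p <- undup (map snd l) | p == x.2) x.1 * e2 p z)).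
  rewrite (exchange_big_dep xpredT) //=; apply: eq_bigr => p _.
  rewrite mulr_suml; apply: eq_bigl => x; exact: eq_sym.
move=> x xl; rewrite -big_filter filter_pred1_uniq ?undup_uniq ?mem_undup ?map_f //.
by rewrite big_seq1.
Qed.

Lemma trig2_onP (F : set (int * int)) (t : R * R -> R[i]) : trig2_on F t <->
  exists l : seq (R[i] * (int * int)), (forall x, x \in l -> F x.2) /\
    t = fun z => \sum_(x <- l) x.1 * e2 x.2 z.
Proof.
split => [[/trig2P[l tE] tF]|[l [lF tE]]]; last first.
  split; first by apply/trig2P; exists l.
  move=> p; rewrite /freq /= tE fourier_coef_sum => /negP; apply: contra_notP => Fp.
  rewrite big_seq_cond big_pred0 // => x; apply/negP => /andP[xl /eqP xp].
  by apply: Fp; rewrite -xp; exact: lF.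
(* Terms of [l] may cancel at a frequency outside [F], so the list is rebuilt from the nonzero
   Fourier coefficients. *)
pose s := [seq p <- undup (map snd l) | fourier_coef t p != 0].
exists [seq (fourier_coef t p, p) | p <- s]; split.
  move=> x /mapP[p]; rewrite mem_filter => /andP[p0 _] ->; exact: tF.
apply/funext => z; rewrite big_map big_filter big_mkcond /=.
transitivity (\sum_(p <- undup (map snd l)) fourier_coef t p * e2 p z); last first.
  by apply: eq_bigr => p _; case: eqVneq => [->|_] /=; rewrite ?mul0r.
rewrite {1}tE.
have cE p : fourier_coef t p * e2 p z = \sum_(x <- l | x.2 == p) x.1 * e2 p z.
  by rewrite tE fourier_coef_sum mulr_suml.
rewrite (eq_bigr _ (fun p _ => cE p)).
rewrite (exchange_big_dep xpredT) //=; apply: eq_big_seq => x xl.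
rewrite -big_filter (eq_filter (a2 := pred1 x.2)); last first.
  by move=> p; rewrite /= eq_sym.
by rewrite filter_pred1_uniq ?undup_uniq ?mem_undup ?map_f // big_seq1.
Qed.

End FourierCoefficients.

(** * Closure properties for a fixed frequency set *)

Section TrigClosure.
Variable R : realType.
Variable F : set (int * int).
Implicit Types t : R * R -> R[i].

Lemma trig2_on_e2 (c : R[i]) p : F p -> trig2_on F (fun z : R * R => c * e2 p z).
Proof.
move=> Fp; apply/trig2_onP; exists [:: (c, p)]; split.
  by move=> x; rewrite inE => /eqP ->.
by apply/funext => z; rewrite big_seq1.
Qed.

Lemma trig2_onD t1 t2 : trig2_on F t1 -> trig2_on F t2 ->
  trig2_on F (fun z => t1 z + t2 z).
Proof.
move=> /trig2_onP[l1 [F1 ->]] /trig2_onP[l2 [F2 ->]].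
apply/trig2_onP; exists (l1 ++ l2); split.
  by move=> x; rewrite mem_cat => /orP[/F1|/F2].
by apply/funext => z; rewrite big_cat.
Qed.

Lemma trig2_on_sum (I : Type) (r : seq I) (f : I -> R * R -> R[i]) :
  (forall i, trig2_on F (f i)) -> trig2_on F (fun z => \sum_(i <- r) f i z).
Proof.
move=> Ff; elim: r => [|i r IH].
  apply/trig2_onP; exists [::]; split => //.
  by apply/funext => z; rewrite !big_nil.
under eq_fun do rewrite big_cons.
exact: (trig2_onD (Ff i) IH).
Qed.

End TrigClosure.

(** * Discrete Fejer means *)

Section FejerSampling.
Variable R : realType.
Notation e := (@expi2pi R).

Definition dirichlet_sum (n : nat) (y : R) : R[i] := \sum_(k < n) e (k%:R * y).

(** This is the Fejer kernel |D_n|^2 / n at j/n - x, divided once more by [n] for averaging over the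
    sample points. *)
Definition fejer_weight (n : nat) (x : R) (j : nat) : R :=
  (cmod (dirichlet_sum n (j%:R / n%:R - x)) / n%:R) ^+ 2.

Lemma fejer_weight_ge0 n x j : 0 <= fejer_weight n x j.
Proof. exact: sqr_ge0. Qed.

Lemma sum_fejer_weight n x : (0 < n)%N -> \sum_(j < n) fejer_weight n x j = 1.
Proof.
move=> n0; have nR : (n%:R : R) != 0 by rewrite pnatr_eq0 -lt0n.
pose p : {poly R[i]} := \poly_(k < n) e (k%:R * - x).
have E j : dirichlet_sum n (j%:R / n%:R - x) = p.[e (j%:R / n%:R)].
  rewrite horner_poly; apply: eq_bigr => k _.
  by rewrite -expi2piXn -expi2piD addrC mulrDr.
under eq_bigr do rewrite /fejer_weight E expr_div_n.
rewrite -mulr_suml parseval ?size_poly //.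
under eq_bigr => k _ do rewrite coef_poly ltn_ord cmod_expi2pi expr1n.
by rewrite sumr_const card_ord -expr2 divff // expf_neq0.
Qed.

(** By the geometric sum, (e(y - x) - 1) D_n(y - x) has modulus at most 2. *)
Lemma fejer_weight_le n x j (delta : R) : (0 < n)%N -> 0 < delta ->
  delta <= cmod (e x - e (j%:R / n%:R)) ->
  fejer_weight n x j <= 4 / (n%:R * delta) ^+ 2.
Proof.
move=> n0 d0; set y := j%:R / n%:R => dy.
have nR : (0 : R) < n%:R by rewrite ltr0n.
have dE : cmod (e x - e y) = cmod (e (y - x) - 1).
  rewrite cmod_distC -[RHS]mul1r -(cmod_expi2pi x) -cmodM mulrBr mulr1 -expi2piD.
  by rewrite [x + _]addrC subrK.
have b : cmod (dirichlet_sum n (y - x)) * delta <= 2.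
  apply: (@le_trans _ _ (cmod (e (y - x) - 1) * cmod (dirichlet_sum n (y - x)))).
    by rewrite mulrC ler_wpM2r ?cmod_ge0 // -dE.
  rewrite -cmodM /dirichlet_sum; under eq_bigr do rewrite expi2piXn.
  rewrite -subrX1; apply: le_trans (cmodB _ _) _.
  by rewrite cmodX cmod_expi2pi expr1n cmod1; lra.
have -> : 4 / (n%:R * delta) ^+ 2 = (2 / (n%:R * delta)) ^+ 2 :> R.
  by rewrite expr_div_n; congr (_ / _); rewrite -natrX.
rewrite /fejer_weight ler_pXn2r ?nnegrE ?divr_ge0 ?cmod_ge0 ?ler0n //; last first.
  by rewrite mulr_ge0 ?ler0n // ltW.
rewrite ler_pdivrMr // mulrAC ler_pdivlMr ?mulr_gt0 //.
by rewrite mulrCA [leRHS]mulrC ler_wpM2l // ltW.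
Qed.

(* The Fejer mean is sampled at the [n]th roots of unity; the weights still sum
   to [1] exactly because the kernel has degree less than [n]. *)
Lemma fejer_approx (g : R -> R[i]) (B delta eta : R) (n : nat) (x : R) :
  (0 < n)%N -> 0 < delta -> (forall y, cmod (g y) <= B) ->
  (forall y, cmod (e x - e y) <= delta -> cmod (g x - g y) <= eta) ->
  8 * B <= eta * n%:R * delta ^+ 2 ->
  cmod (g x - \sum_(j < n) (fejer_weight n x j)%:C * g (j%:R / n%:R)) <= 2 * eta.
Proof.
move=> n0 d0 gB gd hn; have nR : (0 : R) < n%:R by rewrite ltr0n.
have eta0 : 0 <= eta.
  by apply: le_trans (gd x _); rewrite ?cmod_ge0 // subrr cmod0 ltW.
have B0 : 0 <= B := le_trans (cmod_ge0 _) (gB x).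
have {1}-> : g x = \sum_(j < n) (fejer_weight n x j)%:C * g x.
  by rewrite -mulr_suml -rmorph_sum sum_fejer_weight //= mul1r.
rewrite -sumrB; apply: le_trans (cmod_sum _ _ _) _.
(* [D] bounds each term with sample point farther than [delta] from [x]; the [n] of them add up to
   at most 8 B / (n delta^2) <= eta. *)
pose D := 2 * B * (4 / (n%:R * delta) ^+ 2).
have D0 : 0 <= D by rewrite !mulr_ge0 // invr_ge0 sqr_ge0.
apply: (@le_trans _ _ (\sum_(j < n) (fejer_weight n x j * eta + D))).
  apply: ler_sum => j _; rewrite -mulrBr cmodM cmodR ?fejer_weight_ge0 //.
  have [le|gt] := leP (cmod (e x - e (j%:R / n%:R))) delta.
    by apply: ler_wpDr => //; rewrite ler_wpM2l ?fejer_weight_ge0 // gd.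
  apply: ler_wpDl; first by rewrite mulr_ge0 ?fejer_weight_ge0.
  rewrite mulrC ler_pM ?cmod_ge0 ?fejer_weight_ge0 //.
    apply: le_trans (cmodB _ _) _.
    by have := gB x; have := gB (j%:R / n%:R); lra.
  by apply: fejer_weight_le => //; exact: ltW.
rewrite big_split /= -mulr_suml sum_fejer_weight // mul1r sumr_const card_ord.
suff : D *+ n <= eta by lra.
rewrite -mulr_natr /D exprMn.
have -> : 2 * B * (4 / (n%:R ^+ 2 * delta ^+ 2)) * n%:R =
    8 * B / (n%:R * delta ^+ 2).
  by field; rewrite gt_eqF ?gt_eqF.
by rewrite ler_pdivrMr ?mulr_gt0 ?exprn_gt0 // mulrA.
Qed.

(** Expanding |D_n|^2 produces frequencies l - k in x, so [F] must be unrestricted in its first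
    coordinate: this is where slope 0 of the strip enters. *)
Lemma trig2_on_fejer n j (q : {poly R[i]}) (m d : nat) (F : set (int * int)) :
  (size q <= d.+1)%N ->
  (forall (k : int) i, (i <= d)%N -> F (k, i%:Z - m%:Z)) ->
  trig2_on F (fun z => (fejer_weight n z.1 j)%:C * q.[e z.2] * e (- m%:R * z.2)).
Proof.
move=> sq Fd; pose y : R := j%:R / n%:R.
have -> : (fun z : R * R =>
    (fejer_weight n z.1 j)%:C * q.[e z.2] * e (- m%:R * z.2)) =
  fun z => \sum_(k < n) \sum_(l < n) \sum_(i < d.+1)
    (e ((k%:Z - l%:Z)%:~R * y) / n%:R ^+ 2 * q`_i) *
    e2 (l%:Z - k%:Z, i%:Z - m%:Z) z.
  apply/funext => -[a b] /=.
  rewrite /fejer_weight expr_div_n rmorphM /= -sqr_cmod fmorphV rmorphXn rmorph_nat.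
  rewrite /dirichlet_sum -/y rmorph_sum /= big_distrlr /=.
  rewrite -!mulrA mulr_suml; apply: eq_bigr => k _.
  rewrite mulr_suml; apply: eq_bigr => l _.
  rewrite (horner_coef_wide _ sq) mulr_suml !mulr_sumr; apply: eq_bigr => i _.
  rewrite /e2 /= -expi2piXn expi2piJ.
  have -> : e ((l%:Z - k%:Z)%:~R * a + (i%:Z - m%:Z)%:~R * b) =
      e ((l%:R - k%:R) * a) * (e (i%:R * b) * e (- m%:R * b)).
    by rewrite -!expi2piD !intrB -!pmulrn; congr e; ring.
  have -> : e ((k%:Z - l%:Z)%:~R * y) = e ((k%:R - l%:R) * y).
    by rewrite !intrB -!pmulrn.
  rewrite mulrA -expi2piD.
  have -> : e (k%:R * (y - a) + - (l%:R * (y - a))) =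
      e ((k%:R - l%:R) * y) * e ((l%:R - k%:R) * a).
    by rewrite -expi2piD; congr e; ring.
  by ring.
do 3 apply: trig2_on_sum => ?.
by apply: trig2_on_e2; apply: Fd; rewrite -ltnS.
Qed.

End FejerSampling.

(** * The two inclusions *)

Section PropertyA.
Variable R : realType.
Notation e := (@expi2pi R).

Lemma trig2_on_sqnorm (F : set (int * int)) (s : R * R -> R[i]) :
  trig2_on F s -> trig2_on (diffset F) (fun z => `|s z| ^+ 2).
Proof.
move=> /trig2_onP[l [lF ->]]; apply/trig2_onP.
exists [seq (x.1 * (y.1)^*%R, x.2 - y.2) | x <- l, y <- l]; split.
  move=> _ /allpairsP[[x y] /= [xl yl ->]] /=.
  by exists x.2; [exact: lF|exists y.2; [exact: lF|]].
apply/funext => z; rewrite normCK rmorph_sum big_distrlr /= big_allpairs_dep /=.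
apply: eq_bigr => x _; apply: eq_bigr => y _.
rewrite rmorphM mulrACA /e2 /= expi2piJ -expi2piD; congr (_ * e _).
by rewrite !intrB; ring.
Qed.

Lemma fourier_coefB_le (t g : R * R -> R[i]) (eps : R) p :
  trig2 t -> trig2 g -> (forall z, cmod (t z - g z) <= eps) ->
  cmod (fourier_coef t p - fourier_coef g p) <= eps.
Proof.
move=> /trig2P[l1 ->] /trig2P[l2 ->] H; rewrite !fourier_coef_sum.
pose l := l1 ++ [seq (- x.1, x.2) | x <- l2].
have -> : \sum_(x <- l1 | x.2 == p) x.1 - \sum_(x <- l2 | x.2 == p) x.1 =
    \sum_(x <- l | x.2 == p) x.1 :> R[i].
  by rewrite big_cat big_map /= -sumrN.
apply: coef2_le_sup => z.
have -> : \sum_(x <- l) x.1 * e2 x.2 z =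
    \sum_(x <- l1) x.1 * e2 x.2 z - \sum_(x <- l2) x.1 * e2 x.2 z.
  rewrite big_cat big_map /= -sumrN; congr (_ + _).
  by apply: eq_bigr => x _; rewrite mulNr.
exact: H.
Qed.

Lemma specfact2_sub_pos2 (F : set (int * int)) :
  @specfact2 R F `<=` pos2 (diffset F).
Proof.
move=> t [tT /sup_closureP tS].
have appr eps : 0 < eps -> exists2 s, trig2_on F s &
    forall z, cmod (t z - `|s z| ^+ 2) < eps.
  move=> eps0; have [_ [s sF <-] sz] := tS eps eps0.
  by exists s => // z; rewrite -ltcR -cmodE.
split; first split => // p.
  rewrite /freq /= -cmod_gt0 => tp; apply: contrapT => Fp.
  (* If [p] were outside F - F, the coefficient of |s|^2 at [p] would be 0, within half of |t_p| of
     t_p: absurd. *)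
  have [|s /trig2_on_sqnorm[sT sF] sz] := appr (cmod (fourier_coef t p) / 2).
    by rewrite divr_gt0.
  have s0 : fourier_coef (fun z => `|s z| ^+ 2) p = 0.
    by apply/eqP; apply: contra_notT Fp => /sF.
  have := fourier_coefB_le p tT sT (fun z => ltW (sz z)).
  by rewrite s0 subr0; lra.
move=> z; rewrite lecE; apply/andP; split.
  rewrite -normr_eq0 eq_le normr_ge0 andbT; apply/ler_addgt0Pr => eps eps0.
  have [s _ /(_ z) sz] := appr eps eps0; rewrite add0r.
  apply: le_trans (ltW sz); apply: le_trans (cmod_Im _).
  by rewrite cmodE -rmorphXn; case: (t z) => a b /=; rewrite subr0.
apply/ler_addgt0Pr => eps eps0.
have [s _ /(_ z) sz] := appr eps eps0.
have := le_lt_trans (cmod_Re _) sz.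
rewrite cmodE -rmorphXn; case: (t z) => a b /=.
by rewrite ltr_norml => /andP[]; have := sqr_ge0 (cmod (s z)); lra.
Qed.

(** [m] is the largest natural number strictly below [beta]; 0 is a candidate because beta > 0. *)
Lemma strip0_nat (beta : R) : 0 < beta ->
  exists m : nat, forall p : int * int, strip 0 beta p <-> (`|p.2| <= m)%N.
Proof.
move=> b0.
have ex : exists n : nat, n%:R < beta by exists 0.
have bd n : n%:R < beta -> (n <= Num.trunc beta)%N.
  by move=> nb; rewrite -ltnS -(ltr_nat R) (lt_trans nb) // truncnS_gt.
case: (ex_maxnP ex bd) => m mb mx; exists m => p.
have -> : strip 0 beta p <-> (`|p.2|%N%:R : R) < beta.
  by rewrite strip0E /= -intr_norm -abszE -pmulrn.
split=> [/mx //|pm]; apply: le_lt_trans mb; by rewrite ler_nat.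
Qed.

(** * Approximating a nonnegative polynomial by squared moduli *)

Section Approximation.
Variables (l : seq (R[i] * (int * int))) (m : nat).
Let d := m.*2.
Let t z := \sum_(i <- l) i.1 * e2 i.2 z.
Hypothesis freq_l : forall i, i \in l -> (`|i.2.2| <= d)%N.
Hypothesis t_ge0 : forall z, 0 <= t z.

Let tE z : t z = (complex.Re (t z))%:C.
Proof. by rewrite RRe_real // ger0_real. Qed.

(** Multiplying t(x, .) + tau by e(dy) gives a polynomial in e(y), to which [fejer_riesz] applies;
    adding [tau] provides the strict positivity. *)
Lemma spectral_factor (tau x : R) : 0 < tau -> exists q : {poly R[i]},
  [/\ (size q <= d.+1)%N, outer q, 0 < q`_0 &
      forall y, cmod q.[e y] ^+ 2 = complex.Re (t (x, y)) + tau].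
Proof.
move=> tau0.
pose p : {poly R[i]} :=
  \sum_(i <- l) (i.1 * e (i.2.1%:~R * x)) *: 'X^(`|(i.2.2 + d%:Z)%R|%N) +
  tau%:C *: 'X^d.
have pE y : p.[e y] = e y ^+ d * (complex.Re (t (x, y)) + tau)%:C.
  rewrite rmorphD /= -tE hornerD hornerZ hornerXn mulrDr [_ * tau%:C]mulrC.
  congr (_ + _); rewrite horner_sum mulr_sumr; apply: eq_big_seq => i il.
  rewrite hornerZ hornerXn mulrCA -mulrA; congr (_ * _).
  rewrite /e2 /= -!expi2piXn -!expi2piD; congr e.
  have -> : (`|(i.2.2 + d%:Z)%R|%N%:R : R) = i.2.2%:~R + d%:R.
    have id : 0 <= i.2.2 + d%:Z by have := freq_l il; lia.
    by rewrite pmulrn gez0_abs // intrD -pmulrn.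
  by ring.
have sp : (size p <= d.*2.+1)%N.
  apply: leq_trans (size_polyD _ _) _; rewrite geq_max; apply/andP; split.
    rewrite big_seq.
    apply: (big_ind (fun u : {poly R[i]} => size u <= d.*2.+1)%N)
      => [|u v su sv|i /freq_l il].
    - by rewrite size_poly0.
    - by apply: leq_trans (size_polyD _ _) _; rewrite geq_max su.
    - apply: leq_trans (size_scale_leq _ _) _; rewrite size_polyXn ltnS.
      by move: il; move: (i.2.2) => k; clearbody d; lia.
  apply: leq_trans (size_scale_leq _ _) _.
  by rewrite size_polyXn ltnS -addnn leq_addr.
have pos w : cmod w = 1 -> 0 < w ^- d * p.[w].
  move=> /expi2pi_surj[y ->]; rewrite pE mulKf ?expf_neq0 ?expi2pi_neq0 // ltcR.
  by rewrite ltr_wpDl // -ler0c -tE.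
have [q [sq oq qE]] := fejer_riesz sp pos.
have q0 := outer_coef0_neq0 oq.
(* A unimodular factor rotates the constant coefficient to a positive real, as [outer_close]
   requires. *)
pose c : R[i] := (cmod q`_0)%:C / q`_0.
have c1 : cmod c = 1.
  by rewrite cmodM cmodV cmodR ?cmod_ge0 // divff // cmod_eq0.
have c0 : c != 0 by rewrite -cmod_gt0 c1.
exists (c%:P * q); split.
- by rewrite mul_polyC size_scale.
- by apply: outerM => //; exact: outerC.
- by rewrite coefCM divfK // ltcR cmod_gt0.
- move=> y; rewrite hornerM hornerC cmodM c1 mul1r; apply: complexI.
  apply: (mulfI (expf_neq0 d (expi2pi_neq0 y))).
  by rewrite -pE qE // cmod_expi2pi.
Qed.

Lemma sqnorm_approx (F : set (int * int)) (eps : R) :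
  (forall p, (`|p.2| <= m)%N -> F p) -> 0 < eps ->
  exists2 s, trig2_on F s & forall z, `|t z - `|s z| ^+ 2| < eps%:C.
Proof.
(* Half of [eps] pays for adding [tau], half for the Fejer mean. *)
move=> Fm eps0; pose tau := eps / 2.
have tau0 : 0 < tau by rewrite divr_gt0.
have [Q QP] := choice (fun x => spectral_factor x tau0).
have sQ x : (size (Q x) <= d.+1)%N by have [] := QP x.
have oQ x : outer (Q x) by have [] := QP x.
have Q0 x : 0 < (Q x)`_0 by have [] := QP x.
have QE x y : cmod (Q x).[e y] ^+ 2 = complex.Re (t (x, y)) + tau.
  by have [] := QP x.
pose M := \sum_(i <- l) cmod i.1.
have M0 : 0 <= M by rewrite sumr_ge0 // => i _; exact: cmod_ge0.
have tM z : complex.Re (t z) <= M.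
  apply: le_trans (ler_norm _) _; apply: le_trans (cmod_Re _) _.
  apply: le_trans (cmod_sum _ _ _) _; apply: ler_sum => i _.
  by rewrite cmodM cmod_expi2pi mulr1.
pose B := M + tau + 1; have B1 : 1 <= B by rewrite lerDr addr_ge0 // ltW.
have QB x y : cmod (Q x).[e y] <= B.
  rewrite -(ler_pXn2r (n := 2)) ?nnegrE ?cmod_ge0 ?(le_trans ler01) // QE.
  apply: (@le_trans _ _ B); first by rewrite /B; have := tM (x, y); lra.
  by rewrite expr2 ler_peMl // (le_trans ler01).
pose L := \sum_(i <- l) cmod i.1 * `|i.2.1|%N%:R.
have L0 : 0 <= L by rewrite sumr_ge0 // => i _; rewrite mulr_ge0 ?cmod_ge0.
have tL x x' y :
    complex.Re (t (x, y)) - complex.Re (t (x', y)) <= L * cmod (e x - e x').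
  rewrite -raddfB /=; apply: le_trans (ler_norm _) _.
  apply: le_trans (cmod_Re _) _; rewrite /t -sumrB.
  apply: le_trans (cmod_sum _ _ _) _; rewrite /L mulr_suml.
  apply: ler_sum => i _; rewrite -mulrBr /e2 /= !expi2piD -mulrBl !cmodM.
  rewrite cmod_expi2pi mulr1 -mulrA ler_wpM2l ?cmod_ge0 //.
  exact: dist_expi2piMz.
(* Chosen so that 2 eta (2 B + 2 eta), the error on squared moduli, is below [tau]. *)
pose eta := Num.min 1 (tau / (8 * (B + 1))).
have B10 : 0 < 8 * (B + 1) by lra.
have eta0 : 0 < eta by rewrite lt_min ltr01 divr_gt0.
have eta1 : eta <= 1 by rewrite ge_min lexx.
have etaB : eta * (8 * (B + 1)) <= tau by rewrite -ler_pdivlMr // ge_min lexx orbT.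
(* The d + 1 coefficients may each move by [mu]; [kap0] is the relative change of |Q|^2 for which
   [outer_close] ensures this. *)
pose mu := eta / d.+1%:R.
have mu0 : 0 < mu by rewrite divr_gt0 // ltr0n.
have BB0 : 0 < 10 * B ^+ 2 by rewrite mulr_gt0 // exprn_gt0 // (lt_le_trans ltr01).
pose kap0 := Num.min 1 (mu ^+ 2 / (10 * B ^+ 2)).
have kap00 : 0 < kap0 by rewrite lt_min ltr01 divr_gt0 // exprn_gt0.
have kap01 : kap0 <= 1 by rewrite ge_min lexx.
have kap0B : 10 * B ^+ 2 * kap0 <= mu ^+ 2.
  by rewrite mulrC -ler_pdivlMr // ge_min lexx orbT.
have L10 : 0 < L + 1 by rewrite ltr_wpDl.
(* As |Q|^2 >= tau, a change of t by at most tau * kap0 is a relative change of at most [kap0]. *)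
pose delta := tau * kap0 / (L + 1).
have delta0 : 0 < delta by rewrite divr_gt0 // mulr_gt0.
have Ldelta a : 0 <= a -> a <= delta -> L * a <= tau * kap0.
  move=> a0 ad; apply: (@le_trans _ _ ((L + 1) * delta)).
    by rewrite ler_pM // lerDl.
  by rewrite mulrC divfK // gt_eqF.
have tauQ x y : tau <= cmod (Q x).[e y] ^+ 2.
  by rewrite QE lerDr -ler0c -tE.
have Qsq x x' y : cmod (e x - e x') <= delta ->
    cmod (Q x).[e y] ^+ 2 <= (1 + kap0) * cmod (Q x').[e y] ^+ 2.
  move=> xx'; have h1 := tL x x' y; have h2 := Ldelta _ (cmod_ge0 _) xx'.
  have h3 := ler_wpM2l (ltW kap00) (tauQ x' y).
  by move: h1 h2 h3; rewrite mulrDl mul1r !QE; clear; lra.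
(* The factors were chosen independently for each [x]; their normalization makes the choice
   continuous. *)
have Qcont x x' y : cmod (e x - e x') <= delta ->
    cmod ((Q x).[e y] - (Q x').[e y]) <= eta.
  move=> xx'; have coefQ k : cmod ((Q x)`_k - (Q x')`_k) <= mu.
    rewrite -(ler_pXn2r (n := 2)) ?nnegrE ?cmod_ge0 ?(ltW mu0) //.
    apply: le_trans kap0B; apply: outer_close => //.
      by rewrite kap01 ltW.
    move=> z /expi2pi_surj[y' ->]; split; [exact: Qsq|apply: Qsq|exact: QB].
    by rewrite cmod_distC.
  rewrite !(horner_coef_wide _ (sQ _)) -sumrB.
  apply: le_trans (cmod_sum _ _ _) _.
  apply: (@le_trans _ _ (\sum_(i < d.+1) mu)).
    by apply: ler_sum => i _; rewrite -mulrBl cmodM cmodX cmod_expi2pi expr1n mulr1.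
  by rewrite sumr_const card_ord -mulr_natr divfK // pnatr_eq0.
pose n := (Num.trunc (8 * B / (eta * delta ^+ 2))).+1.
have nP : 8 * B <= eta * n%:R * delta ^+ 2.
  have ed0 : 0 < eta * delta ^+ 2 by rewrite mulr_gt0 ?exprn_gt0.
  rewrite mulrAC [leRHS]mulrC -ler_pdivrMr //.
  exact/ltW/truncnS_gt.
(* The factor e(-my) shifts the frequencies 0..2m in y to -m..m and leaves the modulus unchanged. *)
pose s z := \sum_(j < n)
  (fejer_weight n z.1 j)%:C * (Q (j%:R / n%:R)).[e z.2] * e (- m%:R * z.2).
exists s.
  apply: trig2_on_sum => j; apply: (@trig2_on_fejer _ _ _ _ _ d) => // k i id.
  by apply: Fm; move: id; rewrite /d /=; clear; lia.
move=> [x y].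
pose a := \sum_(j < n) (fejer_weight n x j)%:C * (Q (j%:R / n%:R)).[e y].
have sa : cmod (s (x, y)) = cmod a.
  by rewrite /s /= -mulr_suml cmodM cmod_expi2pi mulr1.
have aQ : cmod ((Q x).[e y] - a) <= 2 * eta.
  apply: (@fejer_approx _ (fun x => (Q x).[e y]) B delta eta n x) => //.
  by move=> x'; exact: Qcont.
rewrite [t _]tE cmodE sa -rmorphXn -rmorphB /= normc_def ltcR /=.
rewrite expr0n addr0 sqrtr_sqr.
have -> : complex.Re (t (x, y)) = cmod (Q x).[e y] ^+ 2 - tau by rewrite QE addrK.
have b0 := cmod_ge0 (Q x).[e y]; have a0 := cmod_ge0 a; have bB := QB x y.
have h1 := le_trans (cmodB_ge _ _) aQ.
have h2 : cmod a - cmod (Q x).[e y] <= 2 * eta.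
  by apply: le_trans (cmodB_ge _ _) _; rewrite cmod_distC.
have h3 : `|cmod (Q x).[e y] ^+ 2 - cmod a ^+ 2| <= 2 * eta * (2 * B + 2 * eta).
  rewrite subr_sqr normrM ler_pM // ?ler_norml.
    by apply/andP; split; lra.
  by apply/andP; split; lra.
have h4 : 2 * eta * (2 * B + 2 * eta) < tau.
  have : eta * eta <= eta * 1 by rewrite ler_pM2l.
  by move: etaB tau0; clear; lra.
have -> : eps = tau + tau by rewrite /tau; lra.
have := le_lt_trans h3 h4; rewrite !ltr_norml => /andP[h5 h6].
by apply/andP; split; lra.
Qed.

End Approximation.

End PropertyA.

Theorem theorem3p1 (R : realType) (beta : R) (hbeta : 0 < beta) :
  propertyA R (strip 0 beta).
Proof.
have [m mP] := strip0_nat hbeta.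
rewrite /propertyA; apply/seteqP; split; last exact: specfact2_sub_pos2.
move=> t [/trig2_onP[l [lF tE]] t0]; split; first by apply/trig2P; exists l.
apply/sup_closureP => eps eps0.
have lm i : i \in l -> (`|i.2.2| <= m.*2)%N.
  move=> /lF[a /mP am [b /mP bm <-]] /=; lia.
rewrite tE in t0 *.
have [s sF sE] := sqnorm_approx lm t0 (fun p pm => (mP p).2 pm) eps0.
by exists (fun z => `|s z| ^+ 2) => //; exists s.
Qed.
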